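(* Let $1<p<2$, let $X$ be a normed linear space of signed functions on $\mathbb R^6$ with $\mathscr M_{p<2}\subset X$ that controls angular momentum, and suppose that $F(t)\in X$, $t\ge 0$, is a global solution of the Boltzmann equation whose angular momentum is conserved ($J(F(t))=J(F_0)$ for all $t\ge0$). If $J(F_0)\ne0$, then $C_X>0$ and, for every $t\ge0$, $$\operatorname{dist}_X(F(t),\ker_XJ)\ge\frac{\|J(F_0)\|_2}{C_X},\qquad \operatorname{dist}_X(F(t),\mathscr M_{p<2})\ge\frac{\|J(F_0)\|_2}{C_X}.$$ Consequently, there are no sequences $t_n\to\infty$ and $M_n\in\mathscr M_{p<2}$ such that $\|F(t_n)-M_n\|_X\to0$. In the concrete space $X=X_J$, the following sharper estimates hold for every $t\ge0$: $$\inf_{G\in\ker_{X_J}J}\int_{\mathbb R^6}\|x\wedge v\|_2|F(t)-G|\,dx\,dv\ge\|J(F_0)\|_2,\qquad \inf_{M_*\in\mathscr M_{p<2}}\int_{\mathbb R^6}\|x\wedge v\|_2|F(t)-M_*|\,dx\,dv\ge\|J(F_0)\|_2.$$ Finally, let $\mathfrak S_X$ be a class of global nonnegative solutions with trajectories in $X$ (and conserved angular momentum). If $\mathfrak S_X$ contains solutions with nonzero angular momentum whose initial data lie arbitrarily close in $X$ to some $M\in\mathscr M_{p<2}$, then $\mathscr M_{p<2}$ is not locally attractive near $M$ and hence is not locally asymptotically stable there relative to $\mathfrak S_X$.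
   Context: Let $\Phi(x)=\frac1p\langle x\rangle^p$, $\langle x\rangle=(1+|x|^2)^{1/2}$, $x\in\mathbb R^3$. The Boltzmann equation is $\partial_tF+v\cdot\nabla_xF-\nabla_x\Phi\cdot\nabla_vF=Q(F,F)$, $F(0)=F_0$, where $Q(F,G)(v)=\int_{\mathbb R^3\times\mathbb S^2}B(v-v_*,\sigma)[F(v_*')G(v')-F(v_* )G(v)]\,d\sigma dv_*$ with $v'=\frac{v+v_*}2+\frac{|v-v_*|}2\sigma$, $v'_*=\frac{v+v_*}2-\frac{|v-v_*|}2\sigma$, $B=|v-v_*|^\gamma b(\cos\theta)$, $\gamma\in(-3,1]$, $\cos\theta=\frac{v-v_*}{|v-v_*|}\cdot\sigma$, $b\ge0$ supported in $0\le\theta\le\pi/2$ and satisfying either $\int_{\mathbb S^2}b(\hat z\cdot\sigma)d\sigma<\infty$ or $c_b\theta^{-2-2s}\le b(\cos\theta)\le C_b\theta^{-2-2s}$ for $0<\theta\le\pi/2$ with some $s\in(0,1)$, $0<c_b\le C_b<\infty$. $\mathscr M_{p<2}=\{m\exp[-\alpha(\Phi(x)+\frac12|v|^2)]:m>0,\alpha>0\}$. $x\wedge v=xv^\tau-vx^\tau$; $\mathbb R^{3\wedge3}$ is the space of real $3\times3$ skew-symmetric matrices; $\|\cdot\|_2$ is the Frobenius norm. For every signed $G$ for which the integral converges absolutely, $J(G)=\int_{\mathbb R^6}(x\wedge v)G(x,v)\,dx\,dv\in\mathbb R^{3\wedge3}$. $X$ controls angular momentum if $J$ is (defined and) bounded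 on $X$; then $C_X=\|J\|_{\mathcal L(X,\mathbb R^{3\wedge3})}$ is its operator norm. $\ker_XJ=\{G\in X:J(G)=0\}$; $\operatorname{dist}_X(G,\mathcal A)=\inf_{H\in\mathcal A}\|G-H\|_X$. $X_J=L^1(\mathbb R^6,(1+\|x\wedge v\|_2)\,dx\,dv)$ with norm $\int_{\mathbb R^6}(1+\|x\wedge v\|_2)|G|\,dx\,dv$. $\mathscr M_{p<2}$ is locally attractive near $M\in\mathscr M_{p<2}$ relative to $\mathfrak S_X$ if there is $\eta>0$ such that $F\in\mathfrak S_X$ and $\|F_0-M\|_X<\eta$ imply $\operatorname{dist}_X(F(t),\mathscr M_{p<2})\to0$ as $t\to\infty$. It is Lyapunov stable near $M$ relative to $\mathfrak S_X$ if for every $\epsilon>0$ there is $\eta>0$ such that $F\in\mathfrak S_X$ and $\|F_0-M\|_X<\eta$ imply $\sup_{t\ge0}\operatorname{dist}_X(F(t),\mathscr M_{p<2})<\epsilon$. Local asymptotic stability near $M$ relative to $\mathfrak S_X$ means both properties hold. *)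

(* Defs.v *)
From HB Require Import structures.
From mathcomp Require Import all_boot all_order all_algebra.
From mathcomp Require Import all_classical all_reals all_analysis.

Set Implicit Arguments.
Unset Strict Implicit.
Unset Printing Implicit Defensive.

Import Order.TTheory GRing.Theory Num.Theory.
Import numFieldNormedType.Exports.

Local Open Scope classical_set_scope.
Local Open Scope ring_scope.

(* The library proves that [m1 \x m2] is sigma-finite, but the corresponding
   canonical instance is shadowed by the one for products of subprobabilities
   and is never inferred, so that products cannot be iterated.  The alias below
   is [m1 \x m2] with that instance restored. *)
Section product_measure.
Context d1 d2 (T1 : measurableType d1) (T2 : measurableType d2) (R : realType).
Variable m1 : {sigma_finite_measure set T1 -> \bar R}.
Variable m2 : {sigma_finite_measure set T2 -> \bar R}.

Definition prodm := (m1 \x m2)%E.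

HB.instance Definition _ := Measure.on prodm.

Let prodm_sigma_finite : sigma_finite setT prodm.
Proof.
have /sigma_finiteP[F [TF ndF Foo]] := sigma_finiteT m1.
have /sigma_finiteP[G [TG ndG Goo]] := sigma_finiteT m2.
exists (fun n => F n `*` G n).
  rewrite -setXTT TF TG predeqE => -[x y]; split.
    move=> [/= [n _ Fnx] [k _ Gky]]; exists (maxn n k) => //; split.
    - by move: x Fnx; exact/subsetPset/ndF/leq_maxl.
    - by move: y Gky; exact/subsetPset/ndG/leq_maxr.
  by move=> [n _ []/= ? ?]; split; exists n.
move=> k; have [? ?] := Foo k; have [? ?] := Goo k.
split; first exact: measurableX.
by rewrite /prodm product_measure1E// lte_mul_pinfty// ge0_fin_numE.
Qed.

HB.instance Definition _ :=
  Measure_isSigmaFinite.Build _ _ _ prodm prodm_sigma_finite.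

End product_measure.

Section geometry.
Variable R : realType.

(* Products carry both the measurable structure and the normed-module structure
   used for derivatives.  Their library norm is the max norm, hence [enorm]. *)
Definition E3 := (R * R * R)%type.
Definition phase := (E3 * E3)%type.

Definition leb2 := prodm (@lebesgue_measure R) (@lebesgue_measure R).
Definition leb3 := prodm leb2 (@lebesgue_measure R).
Definition leb6 := prodm leb3 leb3.

Definition vec (x : E3) : 'cV[R]_3 :=
  \col_(i < 3) nth 0 [:: x.1.1; x.1.2; x.2] i.

Definition dot (x y : E3) : R := \sum_(i < 3) vec x i 0 * vec y i 0.

Definition enorm (x : E3) : R := Num.sqrt (dot x x).

Definition wedge3 (x v : E3) : 'M[R]_3 :=
  vec x *m (vec v)^T - vec v *m (vec x)^T.

Definition frob (A : 'M[R]_3) : R := Num.sqrt (\sum_i \sum_j A i j ^+ 2).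

Definition grad (f : E3 -> R) (x : E3) : E3 :=
  ('D_((1, 0, 0) : E3) f x, 'D_((0, 1, 0) : E3) f x, 'D_((0, 0, 1) : E3) f x).

End geometry.

Arguments leb2 : clear implicits.
Arguments leb3 : clear implicits.
Arguments leb6 : clear implicits.

Section boltzmann.
Variable R : realType.
Local Notation E3 := (E3 R).
Local Notation phase := (phase R).
Local Notation mu := (@lebesgue_measure R).
Implicit Types (p gamma eps t T : R) (b : R -> R).

Definition Phi p (x : E3) : R := p^-1 * (Num.sqrt (1 + enorm x ^+ 2)) `^ p.

(* The unit sphere in spherical coordinates; its surface measure is
   [sin a.1 da] on the rectangle [angles]. *)
Definition angles : set (R * R) := `[0, pi] `*` `[0, 2 * pi].

Definition sph (a : R * R) : E3 :=
  (sin a.1 * cos a.2, sin a.1 * sin a.2, cos a.1).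

Definition cos_dev (z sigma : E3) : R := dot z sigma / enorm z.

(* [b] is a function of the cosine of the deviation angle, as in b(cos theta). *)
Definition angular_kernel b : Prop :=
  [/\ measurable_fun (`[-1, 1] : set R) b,
      forall theta : R, 0 <= theta <= pi -> 0 <= b (cos theta),
      forall theta : R, pi / 2 < theta <= pi -> b (cos theta) = 0
    & (forall z : E3, enorm z = 1 ->
         (\int[leb2 R]_(a in angles) (b (dot z (sph a)) * sin a.1)%:E < +oo)%E)
      \/
      (exists s cb Cb : R, [/\ 0 < s < 1, 0 < cb, cb <= Cb
         & forall theta : R, 0 < theta <= pi / 2 ->
             cb * theta `^ (- 2 - 2 * s) <= b (cos theta)
               <= Cb * theta `^ (- 2 - 2 * s)])].

Definition kernelB gamma b (z sigma : E3) : R :=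
  enorm z `^ gamma * b (cos_dev z sigma).

Definition post (v vs sigma : E3) : E3 :=
  2^-1 *: (v + vs) + (enorm (v - vs) / 2) *: sigma.

Definition post_star (v vs sigma : E3) : E3 :=
  2^-1 *: (v + vs) - (enorm (v - vs) / 2) *: sigma.

(* For a non-cutoff kernel with s >= 1/2 the collision integral does not converge
   absolutely even for smooth rapidly decaying data: it is understood, as usual,
   as the limit as eps -> 0+ of the integrals over deviation angles >= eps.  When
   the integral converges absolutely this is the plain Lebesgue integral. *)
Definition deviation_ge eps (z : E3) : set (R * R) :=
  angles `&` [set a | cos_dev z (sph a) <= cos eps].

Definition collision_density gamma b (F G : E3 -> R) (v : E3)
    (w : E3 * (R * R)) : R :=
  let: sigma := sph w.2 in
  kernelB gamma b (v - w.1) sigma *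
  (F (post_star v w.1 sigma) * G (post v w.1 sigma) - F w.1 * G v) * sin w.2.1.

Definition is_collision gamma b (F G : E3 -> R) (v : E3) (q : R) : Prop :=
  let D eps := [set w : E3 * (R * R) | deviation_ge eps (v - w.1) w.2] in
  (\forall eps \near 0^'+, (prodm (leb3 R) (leb2 R)).-integrable (D eps)
     (EFin \o collision_density gamma b F G v)) /\
  \int[prodm (leb3 R) (leb2 R)]_(w in D eps) collision_density gamma b F G v w
    @[eps --> 0^'+] --> q.

(* The derivative (d/dt + v . grad_x - grad Phi(x) . grad_v) f at (t, x, v). *)
Definition transport p (f : R -> phase -> R) t (x v : E3) : R :=
  derive1 (fun s => f s (x, v)) t + dot v (grad (fun y => f t (y, v)) x)
  - dot (grad (Phi p) x) (grad (fun w => f t (x, w)) v).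

Definition classical_solution p gamma b (F : R -> phase -> R) : Prop :=
  (forall t (x v : E3), 0 < t ->
     differentiable (fun u : R * phase => F u.1 u.2) (t, (x, v)) /\
     is_collision gamma b (fun w => F t (x, w)) (fun w => F t (x, w)) v
       (transport p F t x v)) /\
  (forall z, F t z @[t --> 0^'+] --> F 0 z).

Fixpoint Ck (V : normedModType R) (n : nat) (f : V -> R) : Prop :=
  continuous f /\
  if n is m.+1 then
    forall u, (forall x, derivable f x u) /\ Ck m (fun x => 'D_u f x)
  else True.

Definition test_function (phi : R -> phase -> R) : Prop :=
  let f := fun u : R * phase => phi u.1 u.2 in
  (forall n, Ck n f) /\ compact (closure [set u | f u != 0]).

(* The limit exists for every smooth [phi] and v <> vs: by symmetry in the
   azimuth, the bracket averages to O(theta^2). *)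
Definition collision_test gamma b (phi : E3 -> R) (v vs : E3) : R :=
  lim (\int[leb2 R]_(a in deviation_ge eps (v - vs))
         (kernelB gamma b (v - vs) (sph a) *
          (phi (post_star v vs (sph a)) + phi (post v vs (sph a))
           - phi vs - phi v) * sin a.1) @[eps --> 0^'+]).

(* Distributional solutions: the collision operator is put on the test function
   by the pre/post-collisional change of variables and the exchange of v and vs,
   the latter being the source of the factor 1/2. *)
Definition weak_solution p gamma b (F : R -> phase -> R) : Prop :=
  forall phi, test_function phi -> forall T, 0 <= T ->
  let transport_term (u : R * phase) :=
    F u.1 u.2 * transport p phi u.1 u.2.1 u.2.2 in
  let collision_term (u : R * (E3 * phase)) :=
    let: (t, (x, (v, vs))) := u in
    F t (x, v) * F t (x, vs)
      * collision_test gamma b (fun w => phi t (x, w)) v vs in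
  [/\ (leb6 R).-integrable setT (fun z => (F T z * phi T z)%:E),
      (prodm mu (leb6 R)).-integrable (`[0, T] `*` setT)
        (EFin \o transport_term),
      (prodm mu (prodm (leb3 R) (leb6 R))).-integrable (`[0, T] `*` setT)
        (EFin \o collision_term)
    & \int[leb6 R]_z (F T z * phi T z) - \int[leb6 R]_z (F 0 z * phi 0 z) =
      \int[prodm mu (leb6 R)]_(u in `[0, T] `*` setT) transport_term u +
      2^-1 * \int[prodm mu (prodm (leb3 R) (leb6 R))]_(u in `[0, T] `*` setT)
               collision_term u].

(* A trajectory t |-> F t with initial datum F 0; only times t >= 0 matter. *)
Definition boltzmann_solution p gamma b (F : R -> phase -> R) : Prop :=
  classical_solution p gamma b F \/ weak_solution p gamma b F.

Definition maxwellians p : set (phase -> R) :=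
  [set M | exists m alpha : R, [/\ 0 < m, 0 < alpha
     & M = fun z => m * expR (- (alpha * (Phi p z.1 + enorm z.2 ^+ 2 / 2)))]].

End boltzmann.

Arguments angles {R}.

Section function_spaces.
Variable R : realType.
Local Notation phase := (phase R).
Local Notation leb6 := (leb6 R).

(* A normed linear space of functions on R^6.  Definiteness is required up to
   null sets only, so that both spaces of genuine functions and Lebesgue-type
   spaces of classes, represented by their members, are covered. *)
Record fspace := FSpace {
  fcarrier : set (phase -> R);
  fnorm : (phase -> R) -> R;
  fspace0 : fcarrier (cst 0);
  fspaceD : forall G H, fcarrier G -> fcarrier H -> fcarrier (G \+ H);
  fspaceZ : forall (a : R) G, fcarrier G -> fcarrier (fun z => a * G z);
  fnorm_ge0 : forall G, fcarrier G -> 0 <= fnorm G;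
  fnormD : forall G H, fcarrier G -> fcarrier H ->
    fnorm (G \+ H) <= fnorm G + fnorm H;
  fnormZ : forall (a : R) G, fcarrier G ->
    fnorm (fun z => a * G z) = `|a| * fnorm G;
  fnorm0_ae : forall G, fcarrier G -> fnorm G = 0 ->
    {ae leb6, forall z, G z = 0} }.

Implicit Types (X : fspace) (G : phase -> R) (F : R -> phase -> R).

Definition ang (z : phase) : 'M[R]_3 := wedge3 z.1 z.2.

(* [J G] is skew-symmetric because [ang z] is. *)
Definition J G : 'M[R]_3 := \matrix_(i, j) \int[leb6]_z (ang z i j * G z).

Definition J_defined G : Prop :=
  forall i j, leb6.-integrable setT (fun z => (ang z i j * G z)%:E).

Definition controls_angular_momentum X : Prop :=
  (forall G, fcarrier X G -> J_defined G) /\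
  exists C : R, forall G, fcarrier X G -> frob (J G) <= C * fnorm X G.

(* The operator norm of J on X, matrices being normed by [frob]. *)
Definition opnormJ X : R :=
  sup [set frob (J G) | G in [set G | fcarrier X G /\ fnorm X G <= 1]].

Definition kerJ X : set (phase -> R) := [set G | fcarrier X G /\ J G = 0].

Definition dist_to X G (A : set (phase -> R)) : R :=
  inf [set fnorm X (G \- H) | H in A].

Section XJ.

Let w (z : phase) : R := 1 + frob (ang z).

Let w_gt0 z : 0 < w z.
Proof. by rewrite /w ltr_pwDl// /frob sqrtr_ge0. Qed.

Definition XJ_carrier : set (phase -> R) :=
  [set G | leb6.-integrable setT (fun z => ((1 + frob (ang z)) * G z)%:E)].

Definition XJ_norm G : R := \int[leb6]_z ((1 + frob (ang z)) * `|G z|).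

Let XJ_abs G : XJ_carrier G ->
  leb6.-integrable setT (fun z => (w z * `|G z|)%:E).
Proof.
move=> /integrable_abse; apply: eq_integrable => // z _ /=.
by rewrite normrM (gtr0_norm (w_gt0 z)).
Qed.

Let XJ0 : XJ_carrier (cst 0).
Proof.
rewrite /XJ_carrier /=; under eq_fun do rewrite mulr0.
exact: integrable0.
Qed.

Let XJD G H : XJ_carrier G -> XJ_carrier H -> XJ_carrier (G \+ H).
Proof.
move=> iG iH; have := integrableD measurableT iG iH.
by apply: eq_integrable => // z _ /=; rewrite mulrDr.
Qed.

Let XJZ (a : R) G : XJ_carrier G -> XJ_carrier (fun z => a * G z).
Proof.
move=> iG; have := integrableZl measurableT a iG.
by apply: eq_integrable => // z _ /=; rewrite mulrCA.
Qed.

Let XJ_ge0 G : XJ_carrier G -> 0 <= XJ_norm G.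
Proof.
move=> _; apply: Rintegral_ge0 => z _; exact: mulr_ge0 (ltW (w_gt0 z)) _.
Qed.

Let XJ_normD G H : XJ_carrier G -> XJ_carrier H ->
  XJ_norm (G \+ H) <= XJ_norm G + XJ_norm H.
Proof.
move=> iG iH; have [aG aH] := (XJ_abs iG, XJ_abs iH).
have aGH := XJ_abs (XJD iG iH).
rewrite /XJ_norm -RintegralD//; apply: le_Rintegral => //.
  exact: integrableD aG aH.
move=> z _ /=; rewrite -mulrDr.
exact: ler_wpM2l (ltW (w_gt0 z)) _ _ (ler_normD _ _).
Qed.

Let XJ_normZ (a : R) G : XJ_carrier G ->
  XJ_norm (fun z => a * G z) = `|a| * XJ_norm G.
Proof.
move=> iG; rewrite /XJ_norm -RintegralZl//; last exact: XJ_abs.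
by apply: eq_Rintegral => z _; rewrite normrM mulrCA.
Qed.

Let XJ_norm0 G : XJ_carrier G -> XJ_norm G = 0 -> {ae leb6, forall z, G z = 0}.
Proof.
move=> iG nG0; have aG := XJ_abs iG.
have : ae_eq leb6 setT (fun z => (w z * G z)%:E) (cst 0%E).
  apply/ae_eq_integral_abs => //; first exact: measurable_int iG.
  have -> : (\int[leb6]_z `|(w z * G z)%:E| = \int[leb6]_z (w z * `|G z|)%:E)%E.
    by apply: eq_integral => z _; rewrite abse_EFin normrM (gtr0_norm (w_gt0 z)).
  by rewrite -(fineK (integrable_fin_num measurableT aG)) [X in X%:E]nG0.
apply: filterS => z /(_ Logic.I) /= [] /eqP.
by rewrite mulf_eq0 (gt_eqF (w_gt0 z)) => /eqP.
Qed.

(* L^1(R^6, (1 + |x /\ v|_2) dx dv). *)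
Definition XJ : fspace :=
  FSpace XJ0 XJD XJZ XJ_ge0 XJ_normD XJ_normZ XJ_norm0.

End XJ.

Definition conservative_solution p gamma b X F : Prop :=
  [/\ forall t, 0 <= t -> fcarrier X (F t),
      boltzmann_solution p gamma b F
    & forall t, 0 <= t -> J (F t) = J (F 0)].

Definition solution_class p gamma b X (S : set (R -> phase -> R)) : Prop :=
  forall F, S F -> conservative_solution p gamma b X F /\
    forall t, 0 <= t -> {ae leb6, forall z, 0 <= F t z}.

Definition locally_attractive p X (S : set (R -> phase -> R)) M : Prop :=
  exists eta : R, 0 < eta /\
    forall F, S F -> fnorm X (F 0 \- M) < eta ->
      dist_to X (F t) (maxwellians p) @[t --> +oo] --> 0.

Definition lyapunov_stable p X (S : set (R -> phase -> R)) M : Prop :=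
  forall eps : R, 0 < eps -> exists eta : R, 0 < eta /\
    forall F, S F -> fnorm X (F 0 \- M) < eta ->
      (ereal_sup [set (dist_to X (F t) (maxwellians p))%:E | t in [set t | (0 <= t)%R]]
       < eps%:E)%E.

Definition locally_asymptotically_stable p X S M : Prop :=
  locally_attractive p X S M /\ lyapunov_stable p X S M.

End function_spaces.

(* Main.v *)
(* A Maxwellian M is even in v while x /\ v is odd in v, and the reflection
   v |-> - v preserves Lebesgue measure, so J M = 0.  Hence for every H in the
   kernel of J, and in particular for every Maxwellian, conservation gives
     |J (F 0)| = |J (F t - H)| <= C_X * |F t - H|_X,
   while in X_J the integral form of Cauchy-Schwarz gives
     |J (F t - H)| <= \int |x /\ v| |F t - H|. *)
Require Import Defs.
From mathcomp Require Import all_boot all_order all_algebra.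
From mathcomp Require Import ring lra.
From mathcomp Require Import all_classical all_reals all_analysis.
From mathcomp Require Import measurable_realfun.

Set Implicit Arguments.
Unset Strict Implicit.
Unset Printing Implicit Defensive.

Import Order.TTheory GRing.Theory Num.Theory.
Import numFieldNormedType.Exports.

Local Open Scope classical_set_scope.
Local Open Scope ring_scope.

(** * The Frobenius norm and its Cauchy-Schwarz inequality *)

Section frobenius.
Variable R : realType.
Implicit Types A B : 'M[R]_3.

Lemma frob_ge0 A : 0 <= frob A.
Proof. exact: sqrtr_ge0. Qed.

Lemma sqr_frob A : frob A ^+ 2 = \sum_i \sum_j A i j ^+ 2.
Proof.
by rewrite sqr_sqrtr// sumr_ge0// => i _; rewrite sumr_ge0// => j _; rewrite sqr_ge0.
Qed.

Lemma frob0 : frob (0 : 'M[R]_3) = 0.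
Proof.
rewrite /frob big1 ?sqrtr0// => i _; rewrite big1// => j _.
by rewrite mxE expr0n.
Qed.

Lemma frobZ a A : frob (a *: A) = `|a| * frob A.
Proof.
rewrite /frob -sqrtr_sqr -sqrtrM ?sqr_ge0// mulr_sumr; congr Num.sqrt.
apply: eq_bigr => i _; rewrite mulr_sumr; apply: eq_bigr => j _.
by rewrite mxE exprMn.
Qed.

Lemma normr_le_frob A i j : `|A i j| <= frob A.
Proof.
rewrite -(ler_pXn2r (n := 2)) ?nnegrE ?frob_ge0// sqr_frob real_normK ?num_real//.
rewrite (bigD1 i)//= (bigD1 j)//= -addrA lerDl addr_ge0// sumr_ge0// => k _.
  exact: sqr_ge0.
by rewrite sumr_ge0// => l _; rewrite sqr_ge0.
Qed.

Lemma frob_eq0 A : frob A = 0 -> A = 0.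
Proof.
move=> A0; apply/matrixP => i j; rewrite mxE; apply/normr0_eq0/eqP.
by rewrite eq_le normr_ge0 andbT -A0 normr_le_frob.
Qed.

Lemma frob_gt0 A : A <> 0 -> 0 < frob A.
Proof.
by move=> A0; rewrite lt_def frob_ge0 andbT; apply/eqP => /frob_eq0.
Qed.

(** With a = |A| and c = |B|, summing (c A_ij - a B_ij)^2 >= 0 over the entries gives 2ac <A,B> <= 2
    a^2 c^2. Division by 2ac requires both norms to be nonzero, so the degenerate cases come
    first. *)
Lemma frob_Cauchy_Schwarz A B :
  \sum_i \sum_j A i j * B i j <= frob A * frob B.
Proof.
have [/frob_eq0 ->|B0] := eqVneq (frob B) 0.
  rewrite frob0 mulr0 big1// => i _; rewrite big1// => j _.
  by rewrite mxE mulr0.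
have [/frob_eq0 ->|A0] := eqVneq (frob A) 0.
  rewrite frob0 mul0r big1// => i _; rewrite big1// => j _.
  by rewrite mxE mul0r.
set a := frob A; set c := frob B.
have ac : 0 < 2 * (a * c).
  by rewrite mulr_gt0// mulr_gt0// lt_def frob_ge0 ?A0 ?B0.
have : \sum_i \sum_j 2 * (a * c) * (A i j * B i j) <=
    \sum_i \sum_j (c ^+ 2 * A i j ^+ 2 + a ^+ 2 * B i j ^+ 2).
  apply: ler_sum => i _; apply: ler_sum => j _.
  by rewrite -subr_ge0 (_ : _ - _ = (c * A i j - a * B i j) ^+ 2) ?sqr_ge0//; ring.
under [X in _ <= X]eq_bigr do rewrite big_split/= -!mulr_sumr.
rewrite big_split/= -!mulr_sumr -!sqr_frob -/a -/c.
under eq_bigr do rewrite -mulr_sumr.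
rewrite -mulr_sumr => h; rewrite -(ler_pM2l ac); apply: le_trans h _.
by rewrite le_eqVlt; apply/orP; left; apply/eqP; ring.
Qed.

End frobenius.

(** * Measure-preserving maps, integrals and product measures *)

Lemma Rintegral_measure_preserving d (T : measurableType d) (R : realType)
    (m : {measure set T -> \bar R}) (f : T -> T) (h : T -> R) :
  measurable_fun [set: T] f ->
  (forall A, measurable A -> m (f @^-1` A) = m A) ->
  m.-integrable setT (EFin \o h) -> m.-integrable setT (EFin \o (h \o f)) ->
  \int[m]_z h (f z) = \int[m]_z h z.
Proof.
move=> mf fP ih ihf.
(* The pushforward of [m] under [f] agrees with [m] on measurable sets, so the claim is the change
   of variables for pushforwards. *)
pose m' := measure_function_pushforward__canonical__measure_function_Measure m mf.
rewrite /Rintegral; congr fine.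
rewrite [RHS](eq_measure_integral m'); last first.
  by move=> A mA _; rewrite -fP.
rewrite (integral_pushforward mf)//.
exact: measurable_int ih.
Qed.

Section measure_preserving.
Context d1 d2 (T1 : measurableType d1) (T2 : measurableType d2) (R : realType).
Variable m1 : {sigma_finite_measure set T1 -> \bar R}.
Variable m2 : {sigma_finite_measure set T2 -> \bar R}.
Variables (f : T1 -> T1) (g : T2 -> T2).
Hypotheses (mf : measurable_fun [set: T1] f) (mg : measurable_fun [set: T2] g).
Hypothesis fP : forall A, measurable A -> m1 (f @^-1` A) = m1 A.
Hypothesis gP : forall A, measurable A -> m2 (g @^-1` A) = m2 A.

Let h (z : T1 * T2) := (f z.1, g z.2).

Lemma measurable_fun_map_pair : measurable_fun setT h.
Proof.
by apply: measurable_fun_pair; exact: measurableT_comp.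
Qed.

(** The pushforward of the product measure agrees with it on measurable rectangles; uniqueness of
    the product of sigma-finite measures does the rest. *)
Lemma prodm_map_pair A : measurable A ->
  prodm m1 m2 (h @^-1` A) = prodm m1 m2 A.
Proof.
move=> mA; have mh := measurable_fun_map_pair.
pose m' := measure_function_pushforward__canonical__measure_function_Measure
  (prodm m1 m2) mh.
rewrite [RHS](@product_measure_unique _ _ _ _ _ m1 m2 m')//.
move=> B C mB mC; rewrite /m'/= /pushforward.
rewrite (_ : h @^-1` (B `*` C) = (f @^-1` B) `*` (g @^-1` C))//.
have mfB : measurable (f @^-1` B) by rewrite -[f @^-1` B]setTI; exact: mf.
have mgC : measurable (g @^-1` C) by rewrite -[g @^-1` C]setTI; exact: mg.
by rewrite /prodm product_measure1E//; congr (_ * _)%E; [exact: fP|exact: gP].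
Qed.

End measure_preserving.

(** * Invariance of Lebesgue measure under velocity reflection *)

Section reflection.
Variable R : realType.
Local Notation mu := (@lebesgue_measure R).
Local Notation M1 := (measurableTypeR R).
Local Notation M3 := (M1 * M1 * M1)%type.

Let mN : measurable_fun setT (-%R : M1 -> M1).
Proof. exact: oppr_measurable. Qed.

(** The preimage of []a, b]] under negation is [[-b, -a[], of the same length, and Lebesgue measure
    is determined by its values on such intervals. *)
Lemma lebesgue_measureN (A : set M1) : measurable A ->
  mu (-%R @^-1` A) = mu A.
Proof.
move=> mA.
pose m' := measure_function_pushforward__canonical__measure_function_Measure
  mu mN.
rewrite [RHS](@lebesgue_measure_unique R m')// => _ [[a b] _ <-].
rewrite /m' /= /pushforward.
rewrite opp_preimage_itvbndbnd !lebesgue_measure_itv/= !lte_fin ltrN2.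
by case: ifP => // _; rewrite -!EFinB opprK addrC.
Qed.

(* The measurable structure inferred on [E3 R] has another display than the one
   carried by [leb3 R]; hence the measurable sets below are typed over [M3]. *)
Definition oppE3 (v : E3 R) : E3 R := (- v.1.1, - v.1.2, - v.2).

Let opp2 (v : M1 * M1) : M1 * M1 := (- v.1, - v.2).

Let m2 : measurable_fun [set: M1 * M1] opp2.
Proof. exact: (measurable_fun_map_pair mN mN). Qed.

Lemma measurable_oppE3 : measurable_fun [set: M3] oppE3.
Proof. exact: (measurable_fun_map_pair m2 mN). Qed.

(** Two applications of [prodm_map_pair] follow the nesting of the product down to the real line. *)
Lemma leb3N (A : set M3) : measurable A -> leb3 R (oppE3 @^-1` A) = leb3 R A.
Proof.
apply: (@prodm_map_pair _ _ _ _ R (leb2 R) mu opp2 -%R m2 mN) => B mB.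
  by apply: (@prodm_map_pair _ _ _ _ R mu mu -%R -%R mN mN) => // C mC;
     exact: lebesgue_measureN.
exact: lebesgue_measureN.
Qed.

Definition reflect_velocity (z : phase R) : phase R := (z.1, oppE3 z.2).

Lemma measurable_reflect_velocity :
  measurable_fun [set: M3 * M3] reflect_velocity.
Proof.
exact: (measurable_fun_map_pair (@measurable_id _ M3 setT) measurable_oppE3).
Qed.

Lemma leb6_reflect_velocity (A : set (M3 * M3)) : measurable A ->
  leb6 R (reflect_velocity @^-1` A) = leb6 R A.
Proof.
apply: (@prodm_map_pair _ _ _ _ R (leb3 R) (leb3 R) id oppE3
  (@measurable_id _ M3 setT) measurable_oppE3) => //.
exact: leb3N.
Qed.

Lemma Rintegral_reflect_velocity (h : phase R -> R) :
  (leb6 R).-integrable setT (EFin \o h) ->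
  (leb6 R).-integrable setT (EFin \o (h \o reflect_velocity)) ->
  \int[leb6 R]_z h (reflect_velocity z) = \int[leb6 R]_z h z.
Proof.
apply: Rintegral_measure_preserving; first exact: measurable_reflect_velocity.
exact: leb6_reflect_velocity.
Qed.

End reflection.

(** * Integrals of finite sums *)

Lemma integrable_Rsum d (T : measurableType d) (R : realType)
    (m : {measure set T -> \bar R}) (I : Type) (s : seq I) (f : I -> T -> R) :
  (forall i, m.-integrable setT (EFin \o f i)) ->
  m.-integrable setT (EFin \o (fun z => \sum_(i <- s) f i z)).
Proof.
move=> fi; have := integrable_sum measurableT s (P := xpredT) (fun i _ => fi i).
by apply: eq_integrable => // z _ /=; rewrite sumEFin.
Qed.

Lemma Rintegral_sum d (T : measurableType d) (R : realType)
    (m : {measure set T -> \bar R}) (I : Type) (s : seq I) (f : I -> T -> R) :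
  (forall i, m.-integrable setT (EFin \o f i)) ->
  \int[m]_z (\sum_(i <- s) f i z) = \sum_(i <- s) \int[m]_z f i z.
Proof.
move=> fi; elim: s => [|i s ih].
  by under eq_Rintegral do rewrite big_nil; rewrite Rintegral_cst// mul0r big_nil.
under eq_Rintegral do rewrite big_cons.
by rewrite RintegralD ?big_cons ?ih//; exact: integrable_Rsum.
Qed.

(** * Parity and measurability of the angular momentum density and of Maxwellians *)

Section angular_momentum.
Variable R : realType.
Local Notation M1 := (measurableTypeR R).
Local Notation M3 := (M1 * M1 * M1)%type.
Implicit Types G H M : phase R -> R.

Lemma vecN (v : E3 R) : vec (oppE3 v) = - vec v.
Proof.
apply/matrixP => i j; rewrite !mxE.
by case: i => -[|[|[|]]].
Qed.

Lemma ang_reflect_velocity (z : phase R) : ang (reflect_velocity z) = - ang z.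
Proof.
rewrite /ang /wedge3 /= vecN linearN mulmxN mulNmx.
by rewrite opprD.
Qed.

Lemma enorm_opp (v : E3 R) : enorm (oppE3 v) = enorm v.
Proof.
rewrite /enorm /dot; congr Num.sqrt; apply: eq_bigr => i _.
by rewrite vecN !mxE mulrNN.
Qed.

Lemma maxwellian_reflect_velocity p G z : maxwellians p G ->
  G (reflect_velocity z) = G z.
Proof. by move=> [m [a [_ _ ->]]]; rewrite /= enorm_opp. Qed.

Lemma measurable_vec d (T : measurableType d) (f : T -> M3) i j :
  measurable_fun setT f -> measurable_fun setT (fun z => vec (f z) i j : M1).
Proof.
move=> mf; under eq_fun do rewrite mxE.
have m1 : measurable_fun setT (fun z => (f z).1) by exact: measurableT_comp.
case: i => -[|[|[|]]]//= _.
- by apply: (measurableT_comp measurable_fst).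
- by apply: (measurableT_comp measurable_snd).
- by apply: (measurableT_comp measurable_snd).
Qed.

Lemma measurable_enorm : measurable_fun [set: M3] (@enorm R).
Proof.
apply: measurableT_comp.
  by apply: continuous_measurable_fun; exact: sqrt_continuous.
by apply: measurable_sum => i; apply: measurable_funM; exact: measurable_vec.
Qed.

Lemma angE (z : phase R) i j :
  ang z i j = vec z.1 i 0 * vec z.2 j 0 - vec z.2 i 0 * vec z.1 j 0.
Proof. by rewrite !mxE !big_ord1 !mxE. Qed.

Lemma measurable_ang i j : measurable_fun [set: M3 * M3] (fun z => ang z i j).
Proof.
under eq_fun do rewrite angE.
by apply: measurable_funB; apply: measurable_funM; exact: measurable_vec.
Qed.

Lemma measurable_frob_ang : measurable_fun [set: M3 * M3] (fun z => frob (ang z)).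
Proof.
apply: measurableT_comp.
  by apply: continuous_measurable_fun; exact: sqrt_continuous.
apply: measurable_sum => i; apply: measurable_sum => j.
by apply: measurable_funX; exact: measurable_ang.
Qed.

(** Lets Maxwellians serve as comparison functions in [XJ R] without prior knowledge that they lie
    in that space. *)
Lemma measurable_maxwellian p G : maxwellians p G ->
  measurable_fun [set: M3 * M3] G.
Proof.
have me2 : measurable_fun [set: M3] (fun x => enorm x ^+ 2).
  by apply: measurable_funX; exact: measurable_enorm.
move=> [m [a [_ _ ->]]]; apply: measurable_funM => //.
apply: measurableT_comp => //; apply: measurableT_comp => //.
apply: measurable_funM => //; apply: measurable_funD.
  apply: measurable_funM => //; apply: (measurableT_comp (measurable_powR p)).
  apply: measurableT_comp.
    by apply: continuous_measurable_fun; exact: sqrt_continuous.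
  by apply: measurable_funD => //; exact: (measurableT_comp me2).
by apply: measurable_funM => //; exact: (measurableT_comp me2).
Qed.

(** * Linearity of [J] and its vanishing on Maxwellians *)

Lemma J_definedB G H : J_defined G -> J_defined H -> J_defined (G \- H).
Proof.
move=> iG iH i j; have := integrableB measurableT (iG i j) (iH i j).
by apply: eq_integrable => // z _ /=; rewrite mulrBr.
Qed.

Lemma JB G H : J_defined G -> J_defined H -> J (G \- H) = J G - J H.
Proof.
move=> iG iH; apply/matrixP => i j; rewrite !mxE -RintegralB//; [|exact: iG|exact: iH].
by apply: eq_Rintegral => z _; rewrite mulrBr.
Qed.

Lemma JZ (a : R) G : J_defined G -> J (fun z => a * G z) = a *: J G.
Proof.
move=> iG; apply/matrixP => i j; rewrite !mxE -RintegralZl//; last exact: iG.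
by apply: eq_Rintegral => z _; rewrite mulrCA.
Qed.

Lemma J_maxwellian p M : maxwellians p M -> J_defined M -> J M = 0.
Proof.
move=> hM iM; apply/matrixP => i j; rewrite !mxE.
set h := fun z : phase R => ang z i j * M z.
have hr (z : phase R) : h (reflect_velocity z) = - h z.
  by rewrite /h ang_reflect_velocity mxE (maxwellian_reflect_velocity _ hM) mulNr.
have ihN : (leb6 R).-integrable setT (EFin \o (h \o @reflect_velocity R)).
  have := integrableN (iM i j).
  by apply: eq_integrable => // z _ /=; rewrite hr.
(* Each entry of the integral is equal to its own negative. *)
have := Rintegral_reflect_velocity (iM i j) ihN.
under eq_Rintegral do rewrite -/(h _) hr -mulN1r.
rewrite RintegralZl//; last exact: iM.
by rewrite -/h; lra.
Qed.

(** * The integral form of Cauchy-Schwarz for [J] *)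

Lemma integrable_frob_ang G : measurable_fun [set: M3 * M3] G ->
  (\int[leb6 R]_z (frob (ang z) * `|G z|)%:E < +oo)%E ->
  (leb6 R).-integrable setT (fun z => (frob (ang z) * `|G z|)%:E).
Proof.
move=> mG ioo; apply/integrableP; split.
  apply/measurable_EFinP; apply: measurable_funM; first exact: measurable_frob_ang.
  exact: measurableT_comp.
apply: le_lt_trans ioo; rewrite le_eqVlt; apply/orP; left; apply/eqP.
by apply: eq_integral => z _; rewrite gee0_abs// lee_fin mulr_ge0// frob_ge0.
Qed.

Lemma frob_ang_J_defined G : measurable_fun [set: M3 * M3] G ->
  (leb6 R).-integrable setT (fun z => (frob (ang z) * `|G z|)%:E) ->
  J_defined G.
Proof.
move=> mG ifG i j; apply: le_integrable ifG => //.
  by apply/measurable_EFinP; apply: measurable_funM => //; exact: measurable_ang.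
move=> z _; rewrite lee_fin normrM [leRHS]ger0_norm; last first.
  by rewrite mulr_ge0// frob_ge0.
by rewrite ler_wpM2r// normr_le_frob.
Qed.

(** Pairing with [J G] itself gives |J G|^2 = \int <J G, ang z> G z <= |J G| \int |ang z| |G z|, and
    a positive |J G| cancels. Extended real values also cover a divergent right-hand side. *)
Lemma frob_J_le G : measurable_fun [set: M3 * M3] G ->
  ((frob (J G))%:E <= \int[leb6 R]_z (frob (ang z) * `|G z|)%:E)%E.
Proof.
move=> mG.
have [ioo|] := ltP (\int[leb6 R]_z (frob (ang z) * `|G z|)%:E)%E +oo%E; last first.
  by rewrite leye_eq => /eqP ->; rewrite leey.
have ifG := integrable_frob_ang mG ioo.
have iJ := frob_ang_J_defined mG ifG.
have [->|J0] := eqVneq (J G) 0.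
  rewrite frob0; apply: integral_ge0 => z _.
  by rewrite lee_fin mulr_ge0// frob_ge0.
have {}J0 : 0 < frob (J G) by apply: frob_gt0; exact/eqP.
rewrite -(fineK (integrable_fin_num measurableT ifG)) lee_fin.
rewrite -(ler_pM2l J0) -expr2 sqr_frob -/(Rintegral _ _ _) -RintegralZl//.
have iJij i j : (leb6 R).-integrable setT
    (EFin \o (fun z => J G i j * (ang z i j * G z))).
  have := integrableZl measurableT (J G i j) (iJ i j).
  exact: eq_integrable.
have iJi i : (leb6 R).-integrable setT
    (EFin \o (fun z => \sum_j J G i j * (ang z i j * G z))).
  by apply: integrable_Rsum => j; exact: iJij.
(* One factor of each squared entry of [J G] is expanded as an integral; the other stays as a
   constant. *)
rewrite (_ : \sum_i _ =
    \int[leb6 R]_z \sum_i \sum_j J G i j * (ang z i j * G z)); last first.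
  rewrite Rintegral_sum; last by move=> i; exact: iJi.
  apply: eq_bigr => i _; rewrite Rintegral_sum; last by move=> j; exact: iJij.
  apply: eq_bigr => j _; rewrite RintegralZl//; last exact: iJ.
  by rewrite expr2 [X in X * _ = _]mxE [X in _ * X = _]mxE [in RHS]mxE.
apply: le_Rintegral => //.
- by apply: integrable_Rsum => i; exact: iJi.
- have := integrableZl measurableT (frob (J G)) ifG.
  exact: eq_integrable.
move=> z _; rewrite [frob (ang z) * _]mulrC.
have -> : `|G z| * frob (ang z) = frob (G z *: ang z) by rewrite frobZ.
apply: le_trans (frob_Cauchy_Schwarz _ _); rewrite le_eqVlt; apply/orP; left.
apply/eqP; apply: eq_bigr => i _; apply: eq_bigr => j _.
have -> : (G z *: ang z) i j = G z * ang z i j by rewrite [LHS]mxE.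
by rewrite [G z * _]mulrC.
Qed.

(** * Lower bounds in the weighted space *)

(** Membership gives measurability of the weighted function only; multiplying by the inverse of the
    positive measurable weight, written as a power of exponent -1, recovers [G]. *)
Lemma XJ_measurable G : XJ_carrier G -> measurable_fun [set: M3 * M3] G.
Proof.
move=> /measurable_int /measurable_EFinP mG.
have w_gt0 z : 0 < 1 + frob (ang z) :> R by rewrite ltr_pwDl// frob_ge0.
have mw : measurable_fun [set: M3 * M3] (fun z => 1 + frob (ang z)).
  by apply: measurable_funD; [exact: measurable_cst|exact: measurable_frob_ang].
have mV := measurableT_comp (measurable_powR (- 1)) mw.
have := measurable_funM mV mG; congr (measurable_fun _ _).
by apply/funext => z /=; rewrite powR_inv1 ?ltW// mulKf// gt_eqF.
Qed.

Lemma XJ_J_defined G : XJ_carrier G -> J_defined G.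
Proof.
move=> iG; have mG := XJ_measurable iG; apply: frob_ang_J_defined => //.
apply: le_integrable iG => //.
  apply/measurable_EFinP; apply: measurable_funM; first exact: measurable_frob_ang.
  exact: measurableT_comp.
move=> z _; rewrite lee_fin !normrM normr_id ler_wpM2r//.
by rewrite !ger0_norm ?addr_ge0 ?frob_ge0// lerDr.
Qed.

(* If the right-hand side is finite then [J H] converges, since [J G] does;
   otherwise there is nothing to prove. *)
Lemma frob_J_le_dist G H : XJ_carrier G -> measurable_fun [set: M3 * M3] H ->
  (J_defined H -> J H = 0) ->
  ((frob (J G))%:E <= \int[leb6 R]_z (frob (ang z) * `|G z - H z|)%:E)%E.
Proof.
move=> iG mH JH0; have mG := XJ_measurable iG.
have mGH : measurable_fun [set: M3 * M3] (G \- H) by exact: measurable_funB.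
have [ioo|] := ltP (\int[leb6 R]_z (frob (ang z) * `|(G \- H) z|)%:E)%E +oo%E;
    last by rewrite leye_eq => /eqP ->; rewrite leey.
have JG := XJ_J_defined iG.
have JGH := frob_ang_J_defined mGH (integrable_frob_ang mGH ioo).
(* [H] is recovered as G - (G - H), both terms having a convergent moment. *)
have JH : J_defined H.
  have := J_definedB JG JGH; congr (J_defined _).
  by apply/funext => z /=; rewrite subKr.
by apply: le_trans (frob_J_le mGH); rewrite JB// JH0// subr0.
Qed.

End angular_momentum.

(** * Operator norm and distances in a space controlling angular momentum *)

Section controlled_space.
Variables (R : realType) (X : fspace R).
Implicit Types (G H : phase R -> R) (A : set (phase R -> R)).

Lemma fcarrierB G H : fcarrier X G -> fcarrier X H -> fcarrier X (G \- H).
Proof.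
move=> XG XH; have := fspaceD XG (fspaceZ (-1) XH); congr (fcarrier X _).
by apply/funext => z /=; rewrite mulN1r.
Qed.

Hypothesis cX : controls_angular_momentum X.

Lemma frob_J_le_opnorm_unit G : fcarrier X G -> fnorm X G <= 1 ->
  frob (J G) <= opnormJ X.
Proof.
have [_ [C JC]] := cX => XG G1; apply: ub_le_sup; last by exists G.
(* The constant [C] may be negative, hence the absolute value. *)
exists `|C| => _ [H [XH H1] <-]; apply: le_trans (JC _ XH) _.
apply: le_trans (ler_wpM2r (fnorm_ge0 XH) (ler_norm C)) _.
by rewrite ler_piMr.
Qed.

Lemma frob_J_le_opnorm G : fcarrier X G -> frob (J G) <= opnormJ X * fnorm X G.
Proof.
have [XJd [C JC]] := cX => XG; have [G0|G0] := eqVneq (fnorm X G) 0.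
  (* Rescaling to unit norm is impossible here; the bound by [C] forces |J G| <= 0. *)
  by have := JC _ XG; rewrite G0 !mulr0.
have {}G0 : 0 < fnorm X G by rewrite lt_def G0 fnorm_ge0.
have := frob_J_le_opnorm_unit (fspaceZ (fnorm X G)^-1 XG).
rewrite fnormZ// JZ; last exact: XJd.
rewrite frobZ ger0_norm ?invr_ge0 ?(ltW G0)// mulVf ?gt_eqF// => /(_ (lexx _)).
by rewrite mulrC ler_pdivrMr.
Qed.

Lemma opnormJ_gt0 G : fcarrier X G -> J G <> 0 -> 0 < opnormJ X.
Proof.
move=> XG /frob_gt0 JG; have := lt_le_trans JG (frob_J_le_opnorm XG).
have := fnorm_ge0 XG; rewrite le_eqVlt => /predU1P[<-|G0].
  by rewrite mulr0 ltxx.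
by rewrite pmulr_lgt0.
Qed.

(** Control of angular momentum supplies the convergence that the parity argument requires. *)
Lemma maxwellians_kerJ p : maxwellians p `<=` fcarrier X ->
  maxwellians p `<=` kerJ X.
Proof.
move=> pX M hM; have XM := pX _ hM; split => //.
by apply: J_maxwellian hM _; exact: cX.1.
Qed.

(** Since [J] vanishes on [A], J G = J (G - H) for every [H] in [A]. Nonemptiness matters because
    the real infimum of the empty set is 0. *)
Lemma dist_to_ge G A : fcarrier X G -> J G <> 0 -> A !=set0 -> A `<=` kerJ X ->
  frob (J G) / opnormJ X <= dist_to X G A.
Proof.
move=> XG JG [H0 AH0] AX; apply: lb_le_inf; first by exists (fnorm X (G \- H0)), H0.
move=> _ [H /AX[XH JH] <-]; rewrite ler_pdivrMr ?(opnormJ_gt0 XG)// mulrC.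
apply: le_trans (frob_J_le_opnorm (fcarrierB XG XH)).
by rewrite JB ?JH ?subr0//; exact: cX.1.
Qed.

Lemma dist_to_le G A H : fcarrier X G -> A `<=` fcarrier X -> A H ->
  dist_to X G A <= fnorm X (G \- H).
Proof.
move=> XG AX AH; apply: ge_inf; last by exists H.
by exists 0 => _ [K AK <-]; apply: fnorm_ge0; exact: fcarrierB (AX _ AK).
Qed.

End controlled_space.

Lemma maxwellians_neq0 (R : realType) (p : R) : maxwellians p !=set0.
Proof. by eexists; exists 1, 1; split. Qed.

(** * Failure of local attractivity *)

Section attractivity.
Variables (R : realType) (p gamma : R) (b : R -> R) (X : fspace R).
Hypotheses (pX : maxwellians p `<=` fcarrier X).
Hypothesis cX : controls_angular_momentum X.

Lemma dist_to_maxwellians_ge F t : conservative_solution p gamma b X F ->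
  J (F 0) <> 0 -> 0 <= t ->
  frob (J (F 0)) / opnormJ X <= dist_to X (F t) (maxwellians p).
Proof.
move=> [XF _ JF] JF0 t0; rewrite -(JF t)//; apply: dist_to_ge => //.
- exact: XF.
- by rewrite JF.
- exact: maxwellians_neq0.
- exact: maxwellians_kerJ.
Qed.

Lemma not_locally_attractive S M : solution_class p gamma b X S ->
  (forall delta : R, 0 < delta ->
     exists F, [/\ S F, J (F 0) <> 0 & fnorm X (F 0 \- M) < delta]) ->
  ~ locally_attractive p X S M.
Proof.
move=> SX SM [eta [eta0 attr]]; have [F [SF JF0 FM]] := SM _ eta0.
have [cF _] := SX _ SF.
have C0 : 0 < frob (J (F 0)) / opnormJ X.
  rewrite divr_gt0 ?frob_gt0//; have [XF _ _] := cF.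
  by apply: opnormJ_gt0 JF0 => //; exact: XF.
(* Attraction would bring the distance below its positive lower bound, which is constant in time. *)
have /cvgr_lt/(_ _ C0) := attr _ SF FM.
move=> [T [_ small]].
(* This time lies strictly beyond the threshold [T] and is nonnegative, as the lower bound
   demands. *)
have := small (Num.max 0 (T + 1)).
rewrite lt_max ltrDl ltr01 orbT => /(_ isT).
rewrite ltNge => /negP; apply; apply: dist_to_maxwellians_ge => //.
by rewrite le_max lexx.
Qed.

End attractivity.

(** * Assembly of the lower bounds and of the instability statement *)

Theorem proposition8p1 (R : realType) (p gamma : R) (b : R -> R)
    (hp : 1 < p < 2) (hgamma : -3 < gamma <= 1) (hb : angular_kernel b) :
  (* lower bounds in a space X controlling angular momentum *)
  (forall (X : fspace R) (F : R -> phase R -> R),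
     maxwellians p `<=` fcarrier X -> controls_angular_momentum X ->
     conservative_solution p gamma b X F -> J (F 0) <> 0 ->
     [/\ 0 < opnormJ X,
         forall t : R, 0 <= t ->
           frob (J (F 0)) / opnormJ X <= dist_to X (F t) (kerJ X) /\
           frob (J (F 0)) / opnormJ X <= dist_to X (F t) (maxwellians p)
       & ~ exists (t_ : nat -> R) (M_ : nat -> phase R -> R),
             [/\ forall n, 0 <= t_ n,
                 t_ n @[n --> \oo] --> +oo,
                 forall n, maxwellians p (M_ n)
               & fnorm X (F (t_ n) \- M_ n) @[n --> \oo] --> 0]])
  /\
  (* sharper estimates in X_J *)
  (forall F : R -> phase R -> R,
     conservative_solution p gamma b (XJ R) F ->
     forall t : R, 0 <= t ->
       ((frob (J (F 0)))%:E <=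
          ereal_inf [set \int[leb6 R]_z (frob (ang z) * `|F t z - G z|)%:E
                    | G in kerJ (XJ R)])%E /\
       ((frob (J (F 0)))%:E <=
          ereal_inf [set \int[leb6 R]_z (frob (ang z) * `|F t z - M z|)%:E
                    | M in maxwellians p])%E)
  /\
  (* no local attractivity or asymptotic stability *)
  (forall (X : fspace R) (S : set (R -> phase R -> R)) (M : phase R -> R),
     maxwellians p `<=` fcarrier X -> controls_angular_momentum X ->
     solution_class p gamma b X S -> maxwellians p M ->
     (forall delta : R, 0 < delta ->
        exists F, [/\ S F, J (F 0) <> 0 & fnorm X (F 0 \- M) < delta]) ->
     ~ locally_attractive p X S M /\ ~ locally_asymptotically_stable p X S M).
Proof.
split; [|split].
- move=> X F pX cX cF JF0; have [XF _ JF] := cF.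
  have C0 : 0 < opnormJ X by apply: opnormJ_gt0 JF0 => //; exact: XF.
  split => //.
    move=> t t0; split; last exact: (dist_to_maxwellians_ge pX cX cF).
    rewrite -(JF t)//; apply: dist_to_ge => //; first exact: XF.
    + by rewrite JF.
    + by have [M /(maxwellians_kerJ cX pX)] := maxwellians_neq0 p; exists M.
  move=> [t_ [M_ [t0 _ hM]]].
  have D0 : 0 < frob (J (F 0)) / opnormJ X by rewrite divr_gt0// frob_gt0.
  (* At the index [N] the norm is already below the uniform lower bound on the distance to the
     Maxwellians. *)
  move=> /cvgr_lt/(_ _ D0)[N _ /(_ N (leqnn _))].
  rewrite ltNge => /negP; apply.
  apply: le_trans (dist_to_maxwellians_ge pX cX cF JF0 (t0 N)) _.
  exact: dist_to_le (XF _ (t0 N)) pX (hM N).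
- move=> F [XF _ JF] t t0; rewrite -(JF t)//; have XFt := XF t t0.
  (* Kernel elements have zero [J] by definition, Maxwellians by parity once their moment
     converges. *)
  split; apply: le_ereal_inf_tmp => _ [G hG <-]; apply: frob_J_le_dist => //.
  + by have [XG _] := hG; exact: XJ_measurable.
  + by have [_] := hG.
  + exact: measurable_maxwellian hG.
  + exact: J_maxwellian hG.
- move=> X S M pX cX SX _ SM.
  have na := not_locally_attractive pX cX SX SM.
  by split => // -[].
Qed.
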